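(* Let $k\ge1$ be an integer. Then, as power series in $q$ ($|q|<1$), $$\sum_{n=0}^{\infty}N_{2,k}(n)q^n=\frac{(q^{16},-q^6,-q^{10};q^{16})_\infty}{(q;q^2)_{\infty}^{k-1}(q^2;q^2)_{\infty}^k}.$$
   Context: Notation: $(a;q)_\infty=\prod_{j\ge0}(1-aq^j)$ and $(a_1,\dots,a_r;q)_\infty=\prod_{i=1}^r(a_i;q)_\infty$. A $k$-color partition of $n$ is a finite multiset of positive integers (parts), each carrying one of the $k$ colors $color(1),\dots,color(k)$, whose sum is $n$; repetitions are allowed. $\mathcal{N}_k(n)$ is the set of $k$-color partitions of $n$ in which even parts may occur only in the $k-1$ colors $color(2),\dots,color(k)$ (odd parts may occur in all $k$ colors). $N_{2,k}(n)$ is the number of partitions in $\mathcal{N}_k(n)$ in which the number of odd parts in $color(k)$, counted with multiplicity, is even. *)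

(* Defs.v *)
From HB Require Import structures.
From mathcomp Require Import all_boot all_order all_algebra.
From mathcomp Require Import finmap multiset.
From mathcomp Require Import all_classical all_reals all_analysis.
From mathcomp Require Import complex.

Set Implicit Arguments.
Unset Strict Implicit.
Unset Printing Implicit Defensive.

Import Order.TTheory GRing.Theory Num.Theory.
Import numFieldNormedType.Exports.

Local Open Scope mset_scope.
Local Open Scope classical_set_scope.
Local Open Scope nat_scope.

(* A coloured part is a pair (part size, colour).  The colours
   color(1), ..., color(k) are the ordinals of value 0, ..., k.-1. *)
Definition kcolor_partition (k n : nat) (p : {mset nat * 'I_k}) : bool :=
  all (fun x => 0 < x.1) p && (\sum_(x <- p) x.1 == n).

Definition Nk (k n : nat) : set {mset nat * 'I_k} :=
  [set p | kcolor_partition n p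
           && all (fun x => ~~ odd x.1 ==> (0 < val x.2)) p].

(* The number of odd parts in color(k), counted with multiplicity
   ([enum_mset p], the coercion to [seq], repeats elements). *)
Definition odd_parts_last (k : nat) (p : {mset nat * 'I_k}) : nat :=
  count (fun x => odd x.1 && (val x.2 == k.-1)) p.

Lemma finite_Nk (k n : nat) : finite_set (@Nk k n).
Proof.
pose F (t : n.-bseq ('I_n.+1 * 'I_k)) : {mset nat * 'I_k} :=
  seq_mset [seq (val x.1, x.2) | x <- t].
apply: (@sub_finite_set _ _ (F @` setT)); last first.
  by apply: finite_image; exact: finite_finset.
move=> p /= /andP[/andP[/allP p0 /eqP pn] _].
have lex x : x \in enum_mset p -> x.1 <= n.
  by move=> xp; rewrite -pn (big_rem _ xp) leq_addr.
have szp : size (enum_mset p) <= n.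
  rewrite -pn -sum1_size big_seq [leqRHS]big_seq.
  by apply: leq_sum => x /p0.
pose t := [seq (inord x.1 : 'I_n.+1, x.2) | x <- enum_mset p].
have szt : size t <= n by rewrite size_map.
exists (Bseq szt) => //.
rewrite /F /= -[RHS]seq_mset_id -map_comp; congr seq_mset.
rewrite -[RHS]map_id; apply/eq_in_map => -[a c] xp /=.
by rewrite inordK // ltnS; exact: (lex _ xp).
Qed.

(* [fset_set] is the finite set underlying a (provably finite) set. *)
Definition N2 (k n : nat) : nat :=
  #|` fset_set [set p | @Nk k n p /\ ~~ odd (odd_parts_last p)] |%fset.

Local Open Scope ring_scope.

(* (a; q)_oo; [K^o] is [K] with the topology given by its norm. *)
Definition qpoch (K : numFieldType) (a q : K) : K :=
  limn (fun n => \prod_(0 <= j < n) (1 - a * q ^+ j) : K^o).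

(* (a_1, ..., a_r; q)_oo *)
Definition qpochs (K : numFieldType) (s : seq K) (q : K) : K :=
  \prod_(a <- s) qpoch a q.

(* Main.v *)
(* Colouring an odd part of color(k) by a sign s = 1 or s = -1 and averaging
   over s selects the partitions counted by N_{2,k}; for each s the generating
   function is 1 / ((q,q^2;q^2)^(k-1) (sq;q^2)). Since
   (q^2;q^2) / (sq;q^2) = (q^4,-sq,-sq^3;q^4) = sum_m s^m q^(2m^2-m)
   by the Jacobi triple product, averaging over s keeps the terms with m even,
   and these sum to (q^16,-q^6,-q^10;q^16), again by the triple product.

   These identities are proved for truncated products, as congruences modulo
   X^N between polynomials; the triple product comes from the q-binomial
   theorem. To evaluate at q, the error polynomial, which vanishes modulo X^N,
   is dominated coefficientwise by a polynomial bounded at some rho > |q|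
   uniformly in N, so its value at q is O((|q|/rho)^N). *)
Require Import Defs.
From HB Require Import structures.
From mathcomp Require Import all_boot all_order all_algebra.
From mathcomp Require Import finmap multiset.
From mathcomp Require Import all_classical all_reals all_analysis.
From mathcomp Require Import complex.
From mathcomp Require Import ring lra zify.
Set Implicit Arguments.
Unset Strict Implicit.
Unset Printing Implicit Defensive.
Import Order.TTheory GRing.Theory Num.Theory.
Import numFieldNormedType.Exports.
Local Open Scope mset_scope.
Local Open Scope classical_set_scope.
Local Open Scope ring_scope.

(** * The q-binomial theorem and the finite triple product *)

(** The q-Pochhammer symbol $(Q;Q)_n$. *)
Definition qfac (A : comNzRingType) (Q : A) (n : nat) : A :=
  \prod_(i < n) (1 - Q ^+ i.+1).

(** Gaussian binomial coefficients, given by a Pascal rule because quotients of [qfac] values need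
    not make sense in [A]. *)
Fixpoint gbin (A : comNzRingType) (Q : A) (n k : nat) : A :=
  match n, k with
  | _, 0 => 1
  | 0, _.+1 => 0
  | n'.+1, k'.+1 => gbin Q n' k' + Q ^+ k'.+1 * gbin Q n' k'.+1
  end.

Lemma gbin0 (A : comNzRingType) (Q : A) (n : nat) : gbin Q n 0 = 1.
Proof. by case: n. Qed.

Lemma gbin_small (A : comNzRingType) (Q : A) (n k : nat) :
  (n < k)%N -> gbin Q n k = 0.
Proof.
elim: n k => [|n IHn] [|k] //= nk.
by rewrite !IHn ?mulr0 ?addr0 //; apply: ltnW.
Qed.

Lemma qfacS (A : comNzRingType) (Q : A) (n : nat) :
  qfac Q n.+1 = qfac Q n * (1 - Q ^+ n.+1).
Proof. by rewrite /qfac big_ord_recr. Qed.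

(** The quotient formula without division. The Pascal rule reduces it to $1 - Q^{m+j} = (1 - Q^m) +
    Q^m (1 - Q^j)$. *)
Lemma gbin_qfac (A : comNzRingType) (Q : A) (m j : nat) :
  gbin Q (m + j) m * qfac Q m * qfac Q j = qfac Q (m + j).
Proof.
(* The induction is on the total [m + j], which both terms of the Pascal rule lower by one. *)
move: {2}(m + j)%N (erefl (m + j)%N) => n.
elim: n m j => [|n IHn] [|m] j //=.
- by case: j => // _; rewrite /qfac !big_ord0 !mulr1.
- by rewrite gbin0 /qfac big_ord0 !mul1r.
rewrite !addSn => -[mj].
case: j mj => [|j] mj.
  rewrite addn0 in mj *; subst m.
  have /= := IHn n 0%N; rewrite addn0 => /(_ erefl) IH.
  rewrite (gbin_small Q (ltnSn n)) mulr0 addr0 qfacS mulrA.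
  by rewrite mulrAC IH.
have e1 := IHn m j.+1 mj.
have e2 : gbin Q (m + j.+1) m.+1 * qfac Q m.+1 * qfac Q j = qfac Q (m + j.+1).
  by rewrite -addSnnS; apply: IHn; rewrite addSnnS.
rewrite mulrDl mulrDl [in X in X * _ + _]qfacS.
transitivity (gbin Q (m + j.+1) m * qfac Q m * qfac Q j.+1 * (1 - Q ^+ m.+1)
  + Q ^+ m.+1 * (gbin Q (m + j.+1) m.+1 * qfac Q m.+1 * qfac Q j)
    * (1 - Q ^+ j.+1)).
  by rewrite [qfac Q j.+1]qfacS; ring.
rewrite e1 e2 qfacS -[(m + j.+1).+1]addSn exprD; ring.
Qed.

(** Homogeneous in [x] and [y], since it will be used at $x = Q^n$, which need not be invertible.
    The induction splits off the factor $x + y$ and replaces [y] by [y * Q]. *)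
Lemma qbinomial (A : comNzRingType) (Q x y : A) (n : nat) :
  \prod_(i < n) (x + y * Q ^+ i) =
  \sum_(k < n.+1) gbin Q n k * Q ^+ 'C(k, 2) * y ^+ k * x ^+ (n - k).
Proof.
elim: n y => [|n IHn] y.
  by rewrite big_ord0 big_ord_recl big_ord0 /= bin0n !expr0 !mulr1 addr0.
rewrite big_ord_recl /= expr0 mulr1.
under eq_bigr => i _ do rewrite exprS mulrA.
rewrite IHn mulrDl.
rewrite [X in X + _]big_distrr /= [X in _ + X]big_distrr /=.
rewrite [RHS]big_ord_recl [X in X + _]big_ord_recl -addrA; congr (_ + _).
  by rewrite /= !gbin0 bin0n !expr0 !mulr1 !mul1r subn0 -exprS.
have -> : \sum_(i < n) x * (gbin Q n (bump 0 i) * Q ^+ 'C(bump 0 i, 2)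
     * (y * Q) ^+ bump 0 i * x ^+ (n - bump 0 i)) =
  \sum_(i < n.+1) gbin Q n i.+1 * Q ^+ ('C(i.+1, 2) + i.+1)
     * y ^+ i.+1 * x ^+ (n.+1 - i.+1).
  rewrite big_ord_recr /= (gbin_small Q (ltnSn n)) !mul0r addr0.
  apply: eq_bigr => i _; rewrite /bump /= add1n subSS.
  have -> : (n - i = (n - i.+1).+1)%N by have := ltn_ord i; lia.
  by rewrite exprMn exprD [x ^+ _.+1]exprS; ring.
rewrite -big_split /=; apply: eq_bigr => i _.
rewrite /bump /= add1n !subSS !binS !bin1 !exprD exprMn !exprS.
ring.
Qed.

(* z^m Q^(m choose 2) and w^m Q^(m choose 2) are the terms of index m and -m
   of the bilateral theta series. *)
Lemma finite_jacobi (A : idomainType) (Q z w : A) (n : nat) :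
  Q != 0 -> z * w = Q ->
  \prod_(i < n) ((1 + z * Q ^+ i) * (1 + w * Q ^+ i)) =
  gbin Q (n + n) n + \sum_(m < n) Q ^+ 'C(m.+1, 2) *
    (gbin Q (n + n) (n + m.+1) * z ^+ m.+1
     + gbin Q (n + n) (n - m.+1) * w ^+ m.+1).
Proof.
move=> Q0 zw.
have QX0 k : Q ^+ k != 0 by rewrite expf_neq0.
(* This power of [Q] clears the negative exponents that would come from putting $zQ^{-n}$ into the
   q-binomial theorem. *)
apply: (mulfI (QX0 ('C(n, 2) + n * n + n)%N)).
have cst (c : A) : c ^+ n = \prod_(i < n) c by rewrite prodr_const card_ord.
(* The factors with $i \ge n$ give $Q^n(1 + zQ^{i-n})$; the others become the [w] factors through
   $w(Q^{i+1} + z) = Q(1 + wQ^i)$. *)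
have step1 : Q ^+ ('C(n, 2) + n * n + n) *
    \prod_(i < n) ((1 + z * Q ^+ i) * (1 + w * Q ^+ i)) =
    w ^+ n * \prod_(i < n + n) (Q ^+ n + z * Q ^+ i).
  rewrite big_split_ord /= big_split /=.
  have -> : \prod_(i < n) (Q ^+ n + z * Q ^+ (n + i)) =
      Q ^+ (n * n) * \prod_(i < n) (1 + z * Q ^+ i).
    rewrite exprM (cst (Q ^+ n)) -big_split /=.
    by apply: eq_bigr => i _; rewrite exprD; ring.
  have -> : \prod_(i < n) (Q ^+ n + z * Q ^+ i) =
      Q ^+ 'C(n, 2) * \prod_(i < n) (Q ^+ i.+1 + z).
    rewrite (reindex_inj rev_ord_inj) /= -bin2_sum.
    rewrite big_mkord expr_sum [X in X * _](reindex_inj rev_ord_inj) /=.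
    rewrite -big_split /=; apply: eq_bigr => i _.
    have -> : (Q ^+ n = Q ^+ (n - i.+1) * Q ^+ i.+1)%R.
      by rewrite -exprD subnK.
    by ring.
  have : w ^+ n * \prod_(i < n) (Q ^+ i.+1 + z) =
      Q ^+ n * \prod_(i < n) (1 + w * Q ^+ i).
    rewrite !cst -!big_split /=.
    by apply: eq_bigr => i _; rewrite exprS -zw; ring.
  set P1 := \prod_(i < n) (Q ^+ i.+1 + z).
  set P2 := \prod_(i < n) (1 + w * Q ^+ i).
  set P3 := \prod_(i < n) (1 + z * Q ^+ i) => e.
  rewrite !exprD.
  transitivity (Q ^+ 'C(n, 2) * Q ^+ (n * n) * P3 * (Q ^+ n * P2)); first by ring.
  by rewrite -e; ring.
(* Of the $2n+1$ terms, the central one has index 0 in the theta series, those above it give the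
   powers of [z], and those below it, in reverse order, the powers of [w]. *)
rewrite step1 qbinomial -addnS big_split_ord /= big_ord_recl /= addn0.
rewrite mulrDr mulrDr addrCA mulrDr; congr (_ + _).
  rewrite addnK -exprM !exprD.
  have -> : Q ^+ n = z ^+ n * w ^+ n by rewrite -exprMn zw.
  by ring.
rewrite addrC !big_distrr /= [X in _ + X](reindex_inj rev_ord_inj) /=.
rewrite -big_split /=; apply: eq_bigr => m _.
have mn := ltn_ord m.
rewrite /bump /= add1n mulrDr [in RHS]mulrDr.
have bD a b : ('C(a + b, 2) = 'C(a, 2) + a * b + 'C(b, 2))%N.
  elim: b => [|b IHb]; first by rewrite muln0 !addn0.
  by rewrite addnS !binS IHb !bin1 mulnS; lia.
congr (_ + _).
  have -> : (n + n - (n + m.+1) = n - m.+1)%N by lia.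
  rewrite -exprM.
  transitivity (gbin Q (n + n) (n + m.+1)
     * Q ^+ ('C(n + m.+1, 2) + n * (n - m.+1)) * (z * w) ^+ n * z ^+ m.+1).
    by rewrite !exprD exprMn; ring.
  rewrite zw.
  transitivity (gbin Q (n + n) (n + m.+1)
     * Q ^+ ('C(n + m.+1, 2) + n * (n - m.+1) + n) * z ^+ m.+1).
    by rewrite !exprD; ring.
  have -> : ('C(n + m.+1, 2) + n * (n - m.+1) + n =
     'C(n, 2) + n * n + n + 'C(m.+1, 2))%N.
    rewrite bD; have -> : (n * n = n * m.+1 + n * (n - m.+1))%N.
      by rewrite -mulnDr subnKC.
    by lia.
  by rewrite !exprD; ring.
(* Writing $n = j + m + 1$ splits $w^n$ into $w^j w^{m+1}$, and $w^j$ combines with $z^j$ to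
   $Q^j$. *)
have [j nj] : exists j, n = (j + m.+1)%N by exists (n - m.+1)%N; lia.
have -> : (n - m.+1 = j)%N by lia.
have -> : (n + n - j = n + m.+1)%N by lia.
rewrite -exprM.
transitivity (gbin Q (n + n) j * Q ^+ ('C(j, 2) + n * (n + m.+1))
   * (z * w) ^+ j * w ^+ m.+1).
  by rewrite {1}nj !exprD exprMn; ring.
rewrite zw.
transitivity (gbin Q (n + n) j * Q ^+ ('C(j, 2) + n * (n + m.+1) + j)
   * w ^+ m.+1).
  by rewrite !exprD; ring.
have -> : ('C(j, 2) + n * (n + m.+1) + j =
     'C(n, 2) + n * n + n + 'C(m.+1, 2))%N.
  have e2 p : ('C(p.+1, 2) + 'C(p.+1, 2) = p * p.+1)%N.
    by elim: p => // p IHp; rewrite binS bin1; lia.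
  move: (e2 m) nj; move: (nat_of_ord m) => p {}e2 ->; rewrite bD; nia.
by rewrite !exprD; ring.
Qed.

(** * Theta products modulo a power of the variable *)

Definition eqX (A : comNzRingType) (N : nat) (p q : {poly A}) : Prop :=
  forall i, (i < N)%N -> p`_i = q`_i.

Lemma eqX_refl (A : comNzRingType) (N : nat) (p : {poly A}) : eqX N p p.
Proof. by []. Qed.

Lemma eqX_sym (A : comNzRingType) (N : nat) (p q : {poly A}) :
  eqX N p q -> eqX N q p.
Proof. by move=> pq i iN; rewrite pq. Qed.

Lemma eqX_trans (A : comNzRingType) (N : nat) (q p r : {poly A}) :
  eqX N p q -> eqX N q r -> eqX N p r.
Proof. by move=> pq qr i iN; rewrite pq ?qr. Qed.

Lemma eqX_leq (A : comNzRingType) (N M : nat) (p q : {poly A}) :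
  (M <= N)%N -> eqX N p q -> eqX M p q.
Proof. by move=> MN pq i iM; apply: pq; apply: leq_trans MN. Qed.

Lemma eqX_add (A : comNzRingType) (N : nat) (p q p' q' : {poly A}) :
  eqX N p q -> eqX N p' q' -> eqX N (p + p') (q + q').
Proof. by move=> pq pq' i iN; rewrite !coefD pq ?pq'. Qed.

Lemma eqX_mul (A : comNzRingType) (N : nat) (p q p' q' : {poly A}) :
  eqX N p q -> eqX N p' q' -> eqX N (p * p') (q * q').
Proof.
move=> pq pq' i iN; rewrite !coefM; apply: eq_bigr => j _.
rewrite pq ?pq' //; first exact: leq_ltn_trans (leq_subr _ _) iN.
exact: leq_ltn_trans (leq_ord j) iN.
Qed.

Lemma eqX_sum (A : comNzRingType) (N n : nat) (F G : 'I_n -> {poly A}) :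
  (forall i, eqX N (F i) (G i)) -> eqX N (\sum_(i < n) F i) (\sum_(i < n) G i).
Proof. by move=> FG i iN; rewrite !coef_sum; apply: eq_bigr => j _; apply: FG. Qed.

Lemma eqX_prod (A : comNzRingType) (I : Type) (r : seq I) (P : pred I) (N : nat)
    (F G : I -> {poly A}) :
  (forall i, P i -> eqX N (F i) (G i)) ->
  eqX N (\prod_(i <- r | P i) F i) (\prod_(i <- r | P i) G i).
Proof.
by move=> FG; elim/big_ind2: _ => // p1 p2 q1 q2; apply: eqX_mul.
Qed.

Lemma eqX_mulXn (A : comNzRingType) (N M e : nat) (p q : {poly A}) :
  (N <= M + e)%N -> eqX M p q -> eqX N ('X^e * p) ('X^e * q).
Proof.
move=> NMe pq i iN; rewrite !coefXnM; case: ltnP => // ei; apply: pq; lia.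
Qed.

Lemma eqX_Xn0 (A : comNzRingType) (N e : nat) (p : {poly A}) :
  (N <= e)%N -> eqX N (p * 'X^e) 0.
Proof. by move=> Ne i iN; rewrite coefMXn coef0 (leq_trans iN Ne). Qed.

(** Power series with constant term 1 are invertible; strong induction on the coefficient index
    replaces the inverse. *)
Lemma eqX_cancel (A : comNzRingType) (N : nat) (d p q : {poly A}) :
  d`_0 = 1 -> eqX N (p * d) (q * d) -> eqX N p q.
Proof.
move=> d0 pq i; elim/ltn_ind: i => i IH iN.
have := pq i iN; rewrite !coefM !big_ord_recr /= subnn d0 !mulr1.
rewrite (eq_bigr (fun j : 'I_i => q`_j * d`_(i - j))); first by move/addrI.
by move=> j _; rewrite IH // (ltn_trans _ iN).
Qed.

(** The truncation $(-cX^a; X^d)_n$; thus $c = -1$ gives $(X^a; X^d)_n$. *)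
Definition tprod (A : comNzRingType) (c : A) (a d n : nat) : {poly A} :=
  \prod_(i < n) (1 + c%:P * 'X^(a + d * i)).

Lemma tprod_coef0 (A : comNzRingType) (c : A) (a d n : nat) :
  (0 < a)%N -> (tprod c a d n)`_0 = 1.
Proof.
move=> a0; rewrite /tprod -horner_coef0 horner_prod big1 // => i _.
rewrite !hornerE expr0n; case: eqP => [|_]; first by lia.
by rewrite mulr0 addr0.
Qed.

Lemma eqX_tprod (A : comNzRingType) (c : A) (a d n m N : nat) :
  (n <= m)%N -> (N <= a + d * n)%N -> eqX N (tprod c a d m) (tprod c a d n).
Proof.
move=> /subnKC <- Nn; elim: (m - n)%N => [|j IHj]; first by rewrite addn0.
rewrite addnS /tprod big_ord_recr /= -/(tprod c a d (n + j)) -/(tprod c a d n).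
rewrite -[tprod c a d n]mulr1; apply: eqX_mul => //.
rewrite -[X in eqX _ _ X]addr0; apply: eqX_add => //; apply: eqX_Xn0.
by rewrite mulnDr; lia.
Qed.

Lemma qfac_tprod (A : comNzRingType) (d n : nat) :
  qfac ('X^d : {poly A}) n = tprod (-1) d d n.
Proof.
apply: eq_bigr => i _.
by rewrite -exprM polyCN polyC1 mulN1r mulnS.
Qed.

(** For $d > 0$ both products are the power series $(Q;Q)_n (Q;Q)_{a+b} / ((Q;Q)_a (Q;Q)_b)$. All
    four indices are at least [b], so the four factors agree modulo $X^{d(b+1)}$. *)
Lemma eqX_gbin (A : comNzRingType) (d a b n : nat) : (b <= n <= a)%N ->
  let Q : {poly A} := 'X^d in
  eqX (d * b.+1) (qfac Q n * gbin Q (a + b) a) 1 /\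
  eqX (d * b.+1) (qfac Q n * gbin Q (a + b) b) 1.
Proof.
move=> /andP[bn na] Q.
have [->|d0] := posnP d; first by rewrite mul0n; split=> i; rewrite ltn0.
have E m : (b <= m)%N -> eqX (d * b.+1) (qfac Q m) (qfac Q n).
  move=> bm; apply: (@eqX_trans _ _ (qfac Q b)); rewrite !qfac_tprod.
    by apply: eqX_tprod => //; rewrite mulnS.
  by apply: eqX_sym; apply: eqX_tprod => //; rewrite mulnS.
have c0 : (qfac Q n)`_0 = 1 by rewrite qfac_tprod tprod_coef0.
have main k l : (b <= k)%N -> (b <= l)%N ->
    eqX (d * b.+1) (qfac Q n * gbin Q (k + l) k) 1.
  move=> bk bl; apply: (eqX_cancel c0); rewrite mul1r.
  apply: (@eqX_trans _ _ (qfac Q (k + l))); last by apply: E; lia.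
  rewrite -gbin_qfac mulrC mulrA mulrAC; apply: eqX_mul; last exact/eqX_sym/E.
  by rewrite mulrC; apply: eqX_mul => //; apply/eqX_sym/E.
by split; [apply: main|rewrite addnC; apply: main] => //; lia.
Qed.

(** A truncation of $(X^{a+b}, -sX^a, -sX^b; X^{a+b})_\infty$, the product side of the triple
    product identity. *)
Definition theta_prod (A : comNzRingType) (s : A) (a b n : nat) : {poly A} :=
  tprod (-1) (a + b) (a + b) n *
  (tprod s a (a + b) n * tprod s b (a + b) n).

Lemma eqX_theta_prod (A : comNzRingType) (s : A) (a b n m : nat) :
  (0 < a + b)%N -> (n <= m)%N -> eqX n (theta_prod s a b m) (theta_prod s a b n).
Proof.
move=> ab nm; apply: eqX_mul; last apply: eqX_mul.
all: by apply: eqX_tprod => //; nia.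
Qed.

(** Take [finite_jacobi] at $z = sX^a$, $w = sX^b$ and multiply by $(Q;Q)_n$: each Gaussian binomial
    becomes 1 up to an error, which the monomial in front pushes to degree at least [n]. *)
Lemma eqX_jacobi (A : idomainType) (s : A) (a b n : nat) :
  (0 < a + b)%N -> s ^+ 2 = 1 ->
  eqX n (theta_prod s a b n)
    (1 + \sum_(m < n) (s ^+ m.+1)%:P *
       ('X^(a * m.+1 + (a + b) * 'C(m.+1, 2))
        + 'X^(b * m.+1 + (a + b) * 'C(m.+1, 2)))).
Proof.
move=> ab s1; pose Q : {poly A} := 'X^(a + b).
have Q0 : Q != 0 by rewrite -size_poly_eq0 size_polyXn.
have zw : (s%:P * 'X^a) * (s%:P * 'X^b) = Q.
  by rewrite mulrACA -polyCM -expr2 s1 mul1r -exprD.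
have := finite_jacobi n Q0 zw; rewrite big_split /=.
have eP c e : \prod_(i < n) (1 + c%:P * 'X^e * Q ^+ i) = tprod c e (a + b) n.
  by apply: eq_bigr => i _; rewrite -exprM exprD mulrA.
rewrite /theta_prod !eP => ->; rewrite -qfac_tprod -/Q mulrDr; apply: eqX_add.
  have /(_ _)[|H _] := @eqX_gbin A (a + b) n n n; first by rewrite leqnn.
  by apply: eqX_leq H; nia.
rewrite big_distrr /=; apply: eqX_sum => m; have mn := ltn_ord m.
have /(_ _)[|H1 H2] := @eqX_gbin A (a + b) (n + m.+1) (n - m.+1) n.
  by rewrite leq_subr leq_addr.
have e : (n + m.+1 + (n - m.+1) = n + n)%N by lia.
rewrite e -/Q in H1 H2.
have -> : qfac Q n * (Q ^+ 'C(m.+1, 2) *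
    (gbin Q (n + n) (n + m.+1) * (s%:P * 'X^a) ^+ m.+1
     + gbin Q (n + n) (n - m.+1) * (s%:P * 'X^b) ^+ m.+1)) =
  (s ^+ m.+1)%:P * ('X^(a * m.+1 + (a + b) * 'C(m.+1, 2)) *
     (qfac Q n * gbin Q (n + n) (n + m.+1))
   + 'X^(b * m.+1 + (a + b) * 'C(m.+1, 2)) *
     (qfac Q n * gbin Q (n + n) (n - m.+1))).
  by rewrite !exprMn -!exprM -polyC_exp !exprD; ring.
(* The binomials at $n \pm (m+1)$ are known only modulo $X^{(a+b)(n-m)}$; the missing $(a+b)m$ comes
   from $\binom{m+1}{2} \ge m$. *)
have b2 : (m <= 'C(m.+1, 2))%N.
  by rewrite binS bin1 leq_addl.
have le c : (n <= (a + b) * (n - m.+1).+1 + (c * m.+1 + (a + b) * 'C(m.+1, 2)))%N.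
  rewrite addnCA addnC -mulnDr.
  apply: leq_trans (leq_addr _ _); rewrite -[leqLHS]mul1n leq_mul //; lia.
by apply: eqX_mul => //; rewrite -['X^(a * _ + _) in X in eqX _ _ X]mulr1
  -['X^(b * _ + _) in X in eqX _ _ X]mulr1; apply: eqX_add;
  apply: eqX_mulXn; eauto.
Qed.

Lemma big_ord_double (T : Type) (idx : T) (op : Monoid.law idx) (n : nat)
    (F : nat -> T) :
  \big[op/idx]_(i < n.*2) F i = \big[op/idx]_(i < n) op (F i.*2) (F i.*2.+1).
Proof.
elim: n => [|n IHn]; first by rewrite !big_ord0.
by rewrite doubleS !big_ord_recr /= IHn Monoid.mulmA.
Qed.

(* [q^(2 m^2 - m)] runs through both parities of [m]; the even [m = 2 l] give
   [q^(8 l^2 - 2 l)], again a theta series. *)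
Lemma theta_prod_even_part (A : idomainType) (N : nat) :
  eqX N (theta_prod (1 : A) 1 3 N + theta_prod (-1) 1 3 N) (2%:R * theta_prod 1 6 10 N).
Proof.
(* The left side is truncated at [N + N], so that its terms pair into exactly the [N] terms on the
   right. *)
have le (s : A) a b : (0 < a + b)%N -> s ^+ 2 = 1 -> _ :=
  fun h1 h2 => eqX_leq (leq_addr N N) (@eqX_jacobi A s a b (N + N) h1 h2).
have jle (s : A) : eqX N (theta_prod s 1 3 N) (theta_prod s 1 3 (N + N)).
  by apply/eqX_sym/eqX_theta_prod => //; lia.
apply: (eqX_trans (eqX_add (jle 1) (jle (-1)))).
apply: (eqX_trans (eqX_add (le _ _ _ _ _) (le _ _ _ _ _)));
  rewrite ?sqrrN ?expr1n //.
apply: eqX_sym; apply: (eqX_trans (eqX_mul (eqX_refl _) (@eqX_jacobi A _ _ _ _ _ _)));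
  rewrite ?expr1n //.
rewrite addnn addrACA -big_split /=.
rewrite (@big_ord_double _ _ _ N (fun m => (1 ^+ m.+1)%:P *
  ('X^(1 * m.+1 + 4 * 'C(m.+1, 2)) + 'X^(3 * m.+1 + 4 * 'C(m.+1, 2))) +
  ((-1) ^+ m.+1)%:P *
  ('X^(1 * m.+1 + 4 * 'C(m.+1, 2)) + 'X^(3 * m.+1 + 4 * 'C(m.+1, 2))))) /=.
rewrite mulrDr mulr1 big_distrr /= => i _.
apply: (congr1 (fun p : {poly A} => p`_i)); congr (_ + _).
apply: eq_bigr => m _; rewrite !expr1n.
(* Position [m] of the sum has theta index $m+1$: the even positions cancel and the odd ones survive
   twice. *)
have s1 : ((-1) ^+ m.*2.+1 : A) = -1 by rewrite -signr_odd /= odd_double.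
have s2 : ((-1) ^+ m.*2.+2 : A) = 1 by rewrite -signr_odd /= odd_double.
have b2 p : ('C(p.+1, 2) + 'C(p.+1, 2) = p * p.+1)%N.
  by elim: p => // p IHp; rewrite binS bin1; lia.
have e1 : (1 * m.*2.+2 + 4 * 'C(m.*2.+2, 2) = 6 * m.+1 + 16 * 'C(m.+1, 2))%N.
  have := b2 m; have := b2 m.*2.+1; nia.
have e2 : (3 * m.*2.+2 + 4 * 'C(m.*2.+2, 2) = 10 * m.+1 + 16 * 'C(m.+1, 2))%N.
  have := b2 m; have := b2 m.*2.+1; nia.
rewrite s1 s2 e1 e2 polyCN polyC1; ring.
Qed.

(** The factors $(-sX, -sX^3; X^4)$ interleave to $(-sX; X^2)$, whose product with $(sX; X^2)$ is
    $(X^2; X^4)$ as $s^2 = 1$; together with $(X^4; X^4)$ this makes $(X^2; X^2)$. *)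
Lemma theta_prod_quotient (A : comNzRingType) (s : A) (N : nat) : s ^+ 2 = 1 ->
  eqX N (tprod (- s) 1 2 N * theta_prod s 1 3 N) (tprod (-1) 2 2 N).
Proof.
move=> s1.
have -> : theta_prod s 1 3 N = tprod (-1) 4 4 N * tprod s 1 2 N.*2.
  rewrite /theta_prod; congr (_ * _).
  rewrite /tprod (@big_ord_double _ _ _ N (fun i => 1 + s%:P * 'X^(1 + 2 * i))).
  rewrite /= -big_split /=; apply: eq_bigr => i _.
  by congr ((1 + _ * 'X^_) * (1 + _ * 'X^_)); lia.
(* Lengthening to [N.*2] factors, harmless modulo $X^N$, gives each factor its partner in the
   interleaved product. *)
apply: (@eqX_trans _ _ (tprod (- s) 1 2 N.*2 * (tprod (-1) 4 4 N * tprod s 1 2 N.*2))).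
  by apply: eqX_mul => //; apply/eqX_sym/eqX_tprod; lia.
have -> : tprod (- s) 1 2 N.*2 * (tprod (-1) 4 4 N * tprod s 1 2 N.*2) =
  tprod (-1) 4 4 N * tprod (-1) 2 4 N.*2.
  rewrite mulrCA; congr (_ * _); rewrite -big_split; apply: eq_bigr => i _ /=.
  have -> : 'X^(2 + 4 * i) = 'X^(1 + 2 * i) ^+ 2 :> {poly A}.
    by rewrite -exprM; congr ('X^_); lia.
  rewrite !polyCN !mulNr -subr_sqr expr1n polyC1 mul1r exprMn.
  by rewrite -polyC_exp s1 polyC1 mul1r.
apply: (@eqX_trans _ _ (tprod (-1) 4 4 N * tprod (-1) 2 4 N)).
  by apply: eqX_mul => //; apply: eqX_tprod; lia.
have -> : tprod (-1) 4 4 N * tprod (-1) 2 4 N = tprod (-1 : A) 2 2 N.*2.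
  rewrite /tprod (@big_ord_double _ _ _ N (fun i => 1 + (-1)%:P * 'X^(2 + 2 * i))).
  rewrite mulrC /= -big_split /=; apply: eq_bigr => i _.
  by congr ((1 + _ * 'X^_) * (1 + _ * 'X^_)); lia.
by apply: eqX_tprod; lia.
Qed.

(** * Generating functions of coloured partitions *)

Definition part_of (M k : nat) (t : 'I_M * 'I_k) : nat * 'I_k :=
  ((val t.1).+1, t.2).

Lemma part_of_inj (M k : nat) : injective (@part_of M k).
Proof. by move=> [i c] [j d] [] /val_inj-> ->. Qed.

Definition allowed (k : nat) (x : nat * 'I_k) : bool :=
  ~~ odd x.1 ==> (0 < val x.2)%N.

Definition odd_last (k : nat) (x : nat * 'I_k) : bool :=
  odd x.1 && (val x.2 == k.-1).

(** A multiset is encoded by its multiplicities [f], because expanding a product of truncated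
    geometric series gives a sum over such functions. *)
Definition mset_of (M N k : nat) (f : {ffun 'I_M * 'I_k -> 'I_N.+1}) :
    {mset nat * 'I_k} :=
  seq_mset (flatten [seq nseq (f t) (part_of t) | t <- index_enum _]).

Definition supp_allowed (M N k : nat) (f : {ffun 'I_M * 'I_k -> 'I_N.+1}) : bool :=
  [forall t, allowed (part_of t) || (f t == ord0)].

Lemma sum_mset_of (M N k : nat) (f : {ffun 'I_M * 'I_k -> 'I_N.+1})
    (h : nat * 'I_k -> nat) :
  (\sum_(x <- mset_of f) h x = \sum_t f t * h (part_of t))%N.
Proof.
rewrite (perm_big _ (perm_eq_seq_mset _)) /= big_flatten big_map /=.
by apply: eq_bigr => t _; rewrite big_nseq iter_addn_0 mulnC.
Qed.

Lemma count_sum (T : Type) (a : pred T) (s : seq T) :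
  count a s = (\sum_(x <- s) a x)%N.
Proof. by rewrite -sum1_count big_mkcond; apply: eq_bigr => x _; case: (a x). Qed.

Lemma mset_ofE (M N k : nat) (f : {ffun 'I_M * 'I_k -> 'I_N.+1}) x :
  mset_of f x = (\sum_t f t * (part_of t == x))%N.
Proof. by rewrite -count_mem_mset count_sum sum_mset_of. Qed.

Lemma mset_of_part (M N k : nat) (f : {ffun 'I_M * 'I_k -> 'I_N.+1}) t :
  mset_of f (part_of t) = f t.
Proof.
rewrite mset_ofE (bigD1 t) //= eqxx muln1 big1 ?addn0 // => u /negPf ut.
by rewrite (inj_eq (@part_of_inj M k)) ut muln0.
Qed.

Lemma mset_of_inj (M N k : nat) : injective (@mset_of M N k).
Proof.
move=> f g fg; apply/ffunP => t; apply: val_inj.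
by rewrite /= -!mset_of_part fg.
Qed.

Lemma in_mset_of (M N k : nat) (f : {ffun 'I_M * 'I_k -> 'I_N.+1}) x :
  x \in mset_of f -> exists2 t, (0 < f t)%N & x = part_of t.
Proof.
rewrite in_mset mset_ofE lt0n sum_nat_eq0 negb_forall => /existsP[t].
rewrite implyTb muln_eq0 negb_or => /andP[ft].
by rewrite eqb0 negbK => /eqP <-; exists t; rewrite ?lt0n.
Qed.

Lemma mem_Nk (k m : nat) (p : {mset nat * 'I_k}) :
  (p \in fset_set (@Nk k m)) =
  [&& all (fun x => 0 < x.1)%N p, (\sum_(x <- p) x.1 == m)%N & all (@allowed k) p].
Proof.
rewrite in_fset_set; last exact: finite_Nk.
rewrite /Nk /kcolor_partition.
by apply/idP/idP; rewrite inE /= -andbA.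
Qed.

(** In a partition of [m], a part size times its multiplicity is at most [m], so both fit the bounds
    [M] and [N]. *)
Lemma Nk_mset_of (M N k m : nat) (p : {mset nat * 'I_k}) :
  (m <= M)%N -> (m <= N)%N -> p \in fset_set (@Nk k m) ->
  exists f : {ffun 'I_M * 'I_k -> 'I_N.+1}, p = mset_of f.
Proof.
move=> mM mN; rewrite mem_Nk => /and3P[/allP p0 /eqP pm _].
have pE x : (p x * x.1 <= m)%N.
  rewrite -pm -count_mem_mset count_sum big_distrl /=.
  by apply: leq_sum => y _; case: eqP => [->|]; rewrite ?mul1n ?mul0n.
exists [ffun t => inord (p (part_of t))].
apply/msetP => x; have [px|] := boolP (x \in p); last first.
  move=> xp; move: (xp); rewrite -mset_eq0 => /eqP->.
  apply/esym/eqP; rewrite mset_eq0; apply: contra xp => /in_mset_of[t].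
  rewrite ffunE inordK; first by move=> /[swap] ->; rewrite in_mset.
  by rewrite ltnS (leq_trans _ mN) // (leq_trans _ (pE (part_of t))) ?leq_pmulr.
have /= x0 := p0 _ px.
have xm : (x.1 <= m)%N.
  by apply: leq_trans (pE x); rewrite leq_pmull // -in_mset.
have xM : (x.1.-1 < M)%N by rewrite prednK // (leq_trans xm).
have -> : x = part_of (Ordinal xM, x.2).
  by case: x x0 xM {px xm} => a c /= a0 aM; rewrite /part_of /= prednK.
rewrite mset_of_part ffunE inordK // ltnS (leq_trans _ mN) //.
exact: leq_trans (leq_pmulr _ _) (pE _).
Qed.

Lemma sum_Nk (A : comNzRingType) (M N k m : nat) (h : {mset nat * 'I_k} -> A) :
  (m <= M)%N -> (m <= N)%N ->
  \sum_(p <- fset_set (@Nk k m)) h p =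
  \sum_(f : {ffun 'I_M * 'I_k -> 'I_N.+1} |
      supp_allowed f && (\sum_t f t * (part_of t).1 == m)%N) h (mset_of f).
Proof.
move=> mM mN; rewrite -big_enum -(big_map (@mset_of M N k) xpredT h).
apply: perm_big; apply: uniq_perm; first exact: fset_uniq.
  by rewrite map_inj_uniq ?enum_uniq //; apply: mset_of_inj.
have key (f : {ffun 'I_M * 'I_k -> 'I_N.+1}) : (mset_of f \in fset_set (@Nk k m)) =
    supp_allowed f && (\sum_t f t * (part_of t).1 == m)%N.
  rewrite mem_Nk sum_mset_of andbC -andbA andbC.
  have -> : all (fun x => 0 < x.1)%N (mset_of f).
    by apply/allP => x /in_mset_of[t _ ->].
  rewrite andbT; congr (_ && _); apply/allP/forallP => [H t|H x].
    have [|ft] := posnP (f t); first by move=> /eqP ft; rewrite -val_eqE /= ft orbT.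
    by rewrite H // in_mset mset_of_part.
  move=> /in_mset_of[t ft ->]; have := H t; rewrite -val_eqE /= => /orP[//|].
  by rewrite -leqn0 leqNgt ft.
move=> p; apply/idP/mapP => [pN|[f]].
  have [f pf] := Nk_mset_of mM mN pN; exists f => //.
  by rewrite mem_enum unfold_in /= -key -pf.
by rewrite mem_enum unfold_in /= -key => ? ->.
Qed.

Definition part_sign (A : comNzRingType) (s : A) (k : nat) (x : nat * 'I_k) : A :=
  s ^+ odd_last x.

(** Sizes are cut at [M] and multiplicities at [N] to obtain a polynomial; [s] marks the odd parts
    in the last colour. *)
Definition signed_gf (A : comNzRingType) (s : A) (k M N : nat) : {poly A} :=
  \prod_(t : 'I_M * 'I_k | allowed (part_of t))
    \sum_(e < N.+1) ((part_sign s (part_of t))%:P * 'X^((part_of t).1)) ^+ e.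

Lemma coef_signed_gf (A : comNzRingType) (s : A) (k M N m : nat) :
  (m <= M)%N -> (m <= N)%N ->
  (signed_gf s k M N)`_m =
  \sum_(p <- fset_set (@Nk k m)) s ^+ odd_parts_last p.
Proof.
move=> mM mN; rewrite (sum_Nk _ mM mN) /signed_gf big_mkcond /=.
pose F (t : 'I_M * 'I_k) (e : 'I_N.+1) : {poly A} :=
  ((part_sign s (part_of t))%:P * 'X^((part_of t).1)) ^+ e.
(* Omitting a part that is not allowed amounts to forcing its multiplicity to be zero; the product
   then runs over all parts and distributes over functions. *)
transitivity (\prod_t \sum_(e | allowed (part_of t) || (e == ord0)) F t e)`_m.
  apply: (congr1 (fun p : {poly A} => p`_m)); apply: eq_bigr => t _; case: ifP => _ //.
  by rewrite (big_pred1 ord0) // /F expr0.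
rewrite bigA_distr_big_dep coef_sum [RHS]big_mkcondr /=.
apply: eq_big => [f|f _]; first exact: (sameP familyP forallP).
have -> : \prod_t F t (f t) = (s ^+ odd_parts_last (mset_of f))%:P
    * 'X^(\sum_t f t * (part_of t).1)%N.
  rewrite /odd_parts_last count_sum sum_mset_of.
  rewrite !expr_sum rmorph_prod /= -big_split /=.
  apply: eq_bigr => t _; rewrite /F /part_sign exprMn -polyC_exp.
  by rewrite -!exprM mulnC [X in 'X^X]mulnC.
by rewrite coefCM coefXn eq_sym; case: eqP => _; rewrite ?mulr1 ?mulr0.
Qed.

(** The sum $1 + (-1)^j$ is 2 for even $j$ and 0 for odd $j$. *)
Lemma N2_sum (A : comNzRingType) (k m : nat) :
  2%:R * (N2 k m)%:R =
  \sum_(p <- fset_set (@Nk k m)) (1 : A) ^+ odd_parts_last p +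
  \sum_(p <- fset_set (@Nk k m)) (-1) ^+ odd_parts_last p.
Proof.
rewrite -big_split /=.
rewrite (eq_bigr (fun p => if ~~ odd (odd_parts_last p) then 2%:R : A else 0)); last first.
  by move=> p _; rewrite expr1n -signr_odd; case: odd; rewrite /= ?expr0 ?subrr.
rewrite -big_mkcond /= -big_filter big_const_seq count_predT iter_addr_0 -[RHS]mulr_natr.
congr (_ * _%:R); rewrite /N2.
set S := fset_set _.
have Sf : finite_set [set p | @Nk k m p /\ ~~ odd (odd_parts_last p)]%classic.
  by apply: sub_finite_set (finite_Nk k m) => p [].
suff /perm_size -> : perm_eq S [seq p <- fset_set (@Nk k m) | ~~ odd (odd_parts_last p)].
  by [].
apply: uniq_perm => [||p]; rewrite ?filter_uniq ?fset_uniq //.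
rewrite mem_filter in_fset_set // in_fset_set; last exact: finite_Nk.
apply/idP/idP => [/set_mem[pN po]|/andP[po /set_mem pN]].
  by apply/andP; split; last exact: mem_set.
by apply: mem_set.
Qed.

(** Collects the colours of one part size, odd when [b] holds: an odd size has the marked last
    colour and $k-1$ others, an even size loses the first colour. *)
Lemma prod_color (A : comNzRingType) (k : nat) (b : bool) (u v : A) : (0 < k)%N ->
  \prod_(c < k | ~~ b ==> (0 < val c)%N) (if b && (val c == k.-1) then u else v)
  = (if b then u else 1) * v ^+ k.-1.
Proof.
case: k => // k _; case: b => /=.
  rewrite big_ord_recr /= eqxx mulrC; congr (_ * _).
  rewrite (eq_bigr (fun=> v)) ?prodr_const ?card_ord // => c _.
  by rewrite ifF // ltn_eqF.
rewrite big_mkcond big_ord_recl /= !mul1r.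
by rewrite (eq_bigr (fun=> v)) ?prodr_const ?card_ord.
Qed.

(* Multiplying by (1 - y) turns each truncated geometric series into
   1 - y^(N+1). *)
Lemma signed_gf_inverse (A : comNzRingType) (s : A) (k N : nat) : (0 < k)%N ->
  eqX N (signed_gf s k N.*2 N *
     ((tprod (-1) 1 2 N * tprod (-1) 2 2 N) ^+ k.-1 * tprod (- s) 1 2 N)) 1.
Proof.
move=> k0.
pose y (t : 'I_N.*2 * 'I_k) : {poly A} :=
  (part_sign s (part_of t))%:P * 'X^((part_of t).1).
have -> : (tprod (-1) 1 2 N * tprod (-1) 2 2 N) ^+ k.-1 * tprod (- s) 1 2 N =
    \prod_(t | allowed (part_of t)) (1 - y t).
  pose G (i : nat) : {poly A} :=
    (if odd i.+1 then 1 - s%:P * 'X^(i.+1) else 1) * (1 - 'X^(i.+1)) ^+ k.-1.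
  (* Sizes up to [N.*2] comprise [N] odd and [N] even ones, matching the lengths of the [tprod]
     factors. *)
  transitivity (\prod_(i < N.*2) G i).
    rewrite big_ord_double /tprod -big_split /= -prodrXl -big_split /=.
    apply: eq_bigr => i _.
    rewrite /G /= !odd_double /= !polyCN !polyC1 !mulN1r mulNr mul1r exprMn.
    have -> : (1 + 2 * i = i.*2.+1)%N by lia.
    have -> : (2 + 2 * i = i.*2.+2)%N by lia.
    ring.
  transitivity (\prod_(i < N.*2)
      \prod_(c < k | allowed (part_of (i, c))) (1 - y (i, c))).
    apply: eq_bigr => i _; rewrite /G -prod_color //.
    apply: eq_bigr => c _; rewrite /y /part_sign /odd_last /=.
    by case: ifP => _; rewrite ?expr1 ?expr0 ?mul1r.
  by rewrite pair_big_dep /=; apply: eq_big => -[].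
rewrite /signed_gf -big_split /=.
apply: (@eqX_trans _ _
  (\prod_(t : 'I_N.*2 * 'I_k | allowed (part_of t)) 1)); last by rewrite big1.
apply: eqX_prod => t _; rewrite -/(y t).
rewrite mulrC -[X in X - y t](expr1n _ N.+1).
have -> : (1 ^+ N.+1 - y t) * (\sum_(e < N.+1) y t ^+ e) = 1 - y t ^+ N.+1.
  rewrite expr1n -[in RHS](expr1n _ N.+1) subrXX; congr (_ * _).
  by apply: eq_bigr => e _; rewrite expr1n mul1r.
rewrite -[X in eqX _ _ X]addr0; apply: eqX_add => //.
rewrite /y exprMn -mulNr -exprM; apply: eqX_Xn0 => /=; lia.
Qed.

Definition Num_poly (A : comNzRingType) (N : nat) : {poly A} :=
  theta_prod 1 6 10 N.

Definition Den_poly (A : comNzRingType) (k N : nat) : {poly A} :=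
  tprod (-1) 1 2 N ^+ k.-1 * tprod (-1) 2 2 N ^+ k.

(** For each sign, one factor $(X^2; X^2)$ of the denominator is replaced by $(sX; X^2)$ times the
    theta product, and the rest cancels [signed_gf]. *)
Lemma N2_identity (A : idomainType) (k N : nat) : (0 < k)%N ->
  eqX N ((signed_gf 1 k N.*2 N + signed_gf (-1) k N.*2 N) * Den_poly A k N)
    (2%:R * Num_poly A N).
Proof.
move=> k0.
have key (s : A) : s ^+ 2 = 1 ->
    eqX N (signed_gf s k N.*2 N * Den_poly A k N) (theta_prod s 1 3 N).
  move=> s1; have e := eqX_sym (@theta_prod_quotient A s N s1).
  apply: (@eqX_trans _ _ (signed_gf s k N.*2 N *
     ((tprod (-1) 1 2 N * tprod (-1) 2 2 N) ^+ k.-1 * tprod (- s) 1 2 N)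
     * theta_prod s 1 3 N)); last first.
    by rewrite -[X in eqX _ _ X]mul1r; apply: eqX_mul => //; apply: signed_gf_inverse.
  rewrite -mulrA; apply: eqX_mul => //.
  have -> : Den_poly A k N =
     (tprod (-1) 1 2 N * tprod (-1) 2 2 N) ^+ k.-1 * tprod (-1) 2 2 N.
    by rewrite /Den_poly exprMn -{2}(prednK k0) exprSr mulrA.
  by rewrite -mulrA; apply: eqX_mul.
rewrite [X in eqX _ X _]mulrDl; apply: (eqX_trans _ (@theta_prod_even_part A N)).
by apply: eqX_add; apply: key; rewrite ?sqrrN expr1n.
Qed.

(** * Coefficientwise majorants *)

(** Forces the coefficients of [P] to be nonnegative, which evaluation at a positive point relies
    on. *)
Definition majorant (K : numDomainType) (p P : {poly K}) : Prop :=
  forall i, `|p`_i| <= P`_i.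

Lemma majorantD (K : numDomainType) (p q P Q : {poly K}) :
  majorant p P -> majorant q Q -> majorant (p + q) (P + Q).
Proof. by move=> pP qQ i; rewrite !coefD (le_trans (ler_normD _ _)) ?lerD. Qed.

Lemma majorantN (K : numDomainType) (p P : {poly K}) :
  majorant p P -> majorant (- p) P.
Proof. by move=> pP i; rewrite coefN normrN. Qed.

Lemma majorantM (K : numDomainType) (p q P Q : {poly K}) :
  majorant p P -> majorant q Q -> majorant (p * q) (P * Q).
Proof.
move=> pP qQ i; rewrite !coefM (le_trans (ler_norm_sum _ _ _)) //.
by apply: ler_sum => j _; rewrite normrM ler_pM.
Qed.

Lemma majorant_sum (K : numDomainType) (I : Type) (r : seq I) (P : pred I)
    (F G : I -> {poly K}) :
  (forall i, P i -> majorant (F i) (G i)) ->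
  majorant (\sum_(i <- r | P i) F i) (\sum_(i <- r | P i) G i).
Proof.
move=> FG; elim/big_ind2: _ => // [i|p1 p2 q1 q2]; last exact: majorantD.
by rewrite coef0 normr0.
Qed.

Lemma majorant1 (K : numDomainType) : majorant (1 : {poly K}) 1.
Proof. by move=> i; rewrite coef1 normr_nat. Qed.

Lemma majorant_prod (K : numDomainType) (I : Type) (r : seq I) (P : pred I)
    (F G : I -> {poly K}) :
  (forall i, P i -> majorant (F i) (G i)) ->
  majorant (\prod_(i <- r | P i) F i) (\prod_(i <- r | P i) G i).
Proof.
move=> FG; elim/big_ind2: _ => // [|p1 p2 q1 q2]; last exact: majorantM.
exact: majorant1.
Qed.

Lemma majorantX (K : numDomainType) (p P : {poly K}) (n : nat) :
  majorant p P -> majorant (p ^+ n) (P ^+ n).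
Proof.
move=> pP; elim: n => [|n IHn]; first exact: majorant1.
by rewrite !exprS; apply: majorantM.
Qed.

Lemma majorant_monomial (K : numDomainType) (c : K) (n : nat) :
  `|c| <= 1 -> majorant (c%:P * 'X^n) (1%:P * 'X^n).
Proof.
move=> c1 i; rewrite !coefCM coefXn.
by case: eqP => _; rewrite ?mulr1 // !mulr0 normr0.
Qed.

Lemma majorant_tprod (K : numDomainType) (c : K) (a d n : nat) :
  `|c| <= 1 -> majorant (tprod c a d n) (tprod 1 a d n).
Proof.
move=> c1; apply: majorant_prod => i _; apply: majorantD; first exact: majorant1.
exact: majorant_monomial.
Qed.

Lemma majorant_signed_gf (K : numDomainType) (s : K) (k M N : nat) :
  `|s| <= 1 -> majorant (signed_gf s k M N) (signed_gf 1 k M N).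
Proof.
move=> s1; apply: majorant_prod => t _; apply: majorant_sum => e _.
apply: majorantX; rewrite /part_sign expr1n; apply: majorant_monomial.
by rewrite normrX exprn_ile1.
Qed.

Lemma majorant_take (K : numDomainType) (p P : {poly K}) (n : nat) :
  majorant p P -> majorant (take_poly n p) P.
Proof.
move=> pP i; rewrite coef_take_poly; case: ifP => // _.
by rewrite normr0 (le_trans _ (pP i)).
Qed.

(** Only degrees $i \ge N$ contribute, and there $|q|^i \le (|q|/\rho)^N \rho^i$. *)
Lemma horner_tail (K : numFieldType) (N : nat) (p P : {poly K}) (q rho : K) :
  majorant p P -> eqX N p 0 -> 0 < rho -> `|q| <= rho ->
  `|p.[q]| <= (`|q| / rho) ^+ N * P.[rho].
Proof.
move=> pP p0 rho0 qrho; pose n := maxn (size p) (size P).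
rewrite (@horner_coef_wide _ n p) ?leq_maxl //.
rewrite (@horner_coef_wide _ n P) ?leq_maxr // mulr_sumr.
apply: le_trans (ler_norm_sum _ _ _) _; apply: ler_sum => i _.
have P0 : 0 <= P`_i by apply: le_trans (pP i).
have q1 : 0 <= `|q| / rho <= 1.
  by rewrite divr_ge0 ?(ltW rho0) //= ler_pdivrMr // mul1r.
have [iN|Ni] := ltnP i N.
  rewrite (p0 _ iN) coef0 mul0r normr0 !mulr_ge0 ?exprn_ge0 ?(ltW rho0) //.
  by case/andP: q1.
rewrite normrM normrX mulrCA ler_pM ?exprn_ge0 //.
have -> : `|q| ^+ i = (`|q| / rho) ^+ i * rho ^+ i.
  by rewrite -exprMn divfK // gt_eqF.
rewrite ler_pM2r ?exprn_gt0 //.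
by apply: ler_wiXn2l; case/andP: q1.
Qed.

(** The exponent $a + di$ is at least $i$, so one bound serves all [a] and [d]; [1 *] keeps the
    shape of [prod_geometric_bounded]. *)
Lemma tprod1_le (K : numFieldType) (rho : K) (a d n : nat) :
  (0 < d)%N -> 0 <= rho <= 1 ->
  0 <= (tprod 1 a d n).[rho] <= \prod_(i < n) (1 + 1 * rho ^+ i).
Proof.
move=> d0 /andP[r0 r1]; rewrite /tprod horner_prod.
have t0 (i : 'I_n) : 0 <= (1 + 1%:P * 'X^(a + d * i)).[rho] <= 1 + 1 * rho ^+ i.
  rewrite !hornerE ?mul1r addr_ge0 ?exprn_ge0 //= lerD2l.
  by apply: ler_wiXn2l => //; nia.
apply/andP; split; first by apply: prodr_ge0 => i _; case/andP: (t0 i).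
by apply: ler_prod => i _.
Qed.

(** That is, $1/(1-x) \le 1 + x/(1-\rho)$. It serves both to bound [signed_gf] from above and to
    keep [qpoch] away from zero. *)
Lemma geometric_bound (K : numFieldType) (rho x : K) : 0 <= x <= rho -> rho < 1 ->
  1 <= (1 - x) * (1 + x / (1 - rho)).
Proof.
move=> /andP[x0 xr] r1; have r1' : 1 - rho != 0 by rewrite subr_eq0 gt_eqF.
have -> : (1 - x) * (1 + x / (1 - rho)) = 1 + x * (rho - x) / (1 - rho) by field.
by rewrite lerDl divr_ge0 ?mulr_ge0 ?subr_ge0 // ltW.
Qed.

(** Each truncated geometric series is at most $1/(1-x)$ with $x = \rho^{i+1}$. Parts that are not
    allowed get a bound of at least 1 as well, so every size contributes a full [k]-th power. *)
Lemma signed_gf1_le (K : numFieldType) (rho : K) (k M N : nat) :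
  0 <= rho < 1 ->
  0 <= (signed_gf 1 k M N).[rho] <=
    (\prod_(i < M) (1 + rho / (1 - rho) * rho ^+ i)) ^+ k.
Proof.
move=> /andP[r0 r1]; rewrite /signed_gf horner_prod.
have b1 i : 1 <= 1 + rho / (1 - rho) * rho ^+ i.
  by rewrite lerDl !mulr_ge0 ?invr_ge0 ?subr_ge0 ?exprn_ge0 // ltW.
have t0 (t : 'I_M * 'I_k) : 0 <= (\sum_(e < N.+1)
    ((part_sign 1 (part_of t))%:P * 'X^((part_of t).1)) ^+ e).[rho]
    <= 1 + rho / (1 - rho) * rho ^+ t.1.
  pose x := rho ^+ t.1.+1.
  have x0 : 0 <= x <= rho.
    by rewrite /x exprn_ge0 //= exprS ler_piMr // exprn_ile1 // ltW.
  have -> : (\sum_(e < N.+1) ((part_sign 1 (part_of t))%:P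
      * 'X^((part_of t).1)) ^+ e).[rho] = \sum_(e < N.+1) x ^+ e.
    rewrite horner_sum; apply: eq_bigr => e _.
    by rewrite /part_sign expr1n mul1r horner_exp hornerXn.
  have x1 : 0 < 1 - x by rewrite subr_gt0; case/andP: x0 => _ /le_lt_trans ->.
  have /andP[xge0 _] := x0.
  rewrite sumr_ge0 /=; last by move=> e _; rewrite exprn_ge0.
  rewrite -(ler_pM2l x1).
  have -> : rho / (1 - rho) * rho ^+ t.1 = x / (1 - rho).
    by rewrite /x exprS mulrAC.
  apply: le_trans (geometric_bound x0 r1).
  by rewrite -opprB mulNr -subrX1 opprB gerBl exprn_ge0.
apply/andP; split; first by apply: prodr_ge0 => t _; case/andP: (t0 t).
apply: (@le_trans _ _ (\prod_(t : 'I_M * 'I_k) (1 + rho / (1 - rho) * rho ^+ t.1))).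
  rewrite big_mkcond; apply: ler_prod => t _ /=; case: ifP => // _.
  by rewrite ler01 b1.
rewrite -(pair_bigA _ (fun (i : 'I_M) (c : 'I_k) => 1 + rho / (1 - rho) * rho ^+ i)) /=.
rewrite -prodrXl le_eqVlt; apply/orP; left; apply/eqP; apply: eq_bigr => i _.
by rewrite prodr_const card_ord.
Qed.

(** * Infinite products of complex numbers *)

(** In the partial order of [R[i]], being comparable with 0 forces a zero imaginary part. *)
Lemma ge0_complexR (R : realType) (x : R[i]) : 0 <= x ->
  exists2 r : R, 0 <= r & x = (r%:C)%C.
Proof.
move=> x0; exists (complex.Re x); last by rewrite RRe_real // ger0_real.
by move: x0; rewrite lecE => /andP[].
Qed.

(** From $1 + t \le e^t$ and the sum of the geometric series. *)
Lemma prod_geometric_bounded (R : realType) (a rho : R[i]) :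
  0 <= a -> 0 <= rho < 1 ->
  exists2 B : R[i], 0 <= B & forall n, \prod_(i < n) (1 + a * rho ^+ i) <= B.
Proof.
move=> /ge0_complexR[b b0 ->] /andP[/ge0_complexR[r r0 ->]].
rewrite -[1 in X in X -> _](rmorph1 (real_complex R)) ltcR => r1.
exists ((expR (b / (1 - r)))%:C)%C; first by rewrite ler0c expR_ge0.
move=> n; have -> : \prod_(i < n) (1 + b%:C%C * r%:C%C ^+ i) =
    ((\prod_(i < n) (1 + b * r ^+ i))%:C)%C.
  rewrite rmorph_prod /=; apply: eq_bigr => i _.
  by rewrite rmorphD rmorph1 rmorphM rmorphXn.
rewrite lecR; apply: (@le_trans _ _ (\prod_(i < n) expR (b * r ^+ i))).
  apply: ler_prod => i _; rewrite expR_ge1Dx andbT.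
  by rewrite addr_ge0 // mulr_ge0 // exprn_ge0.
rewrite -expR_sum ler_expR -mulr_sumr ler_wpM2l //.
have r1' : 0 < 1 - r by rewrite subr_gt0.
rewrite -(ler_pM2l r1') mulfV ?gt_eqF //.
by rewrite -opprB mulNr -subrX1 opprB gerBl exprn_ge0.
Qed.

Lemma cvg0_geometric (R : realType) (u : nat -> R[i]^o) (B r : R[i]) :
  0 <= r < 1 -> (forall n, `|u n| <= B * r ^+ n) -> u @ \oo --> (0 : R[i]^o).
Proof.
move=> /andP[r0 r1] uB.
have B0 : 0 <= B by have := uB 0; rewrite expr0 mulr1; apply: le_trans.
have [b b0 Bb] := ge0_complexR B0; have [s s0 rs] := ge0_complexR r0.
have s1 : s < 1 by move: r1; rewrite rs -(rmorph1 (real_complex R)) ltcR.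
apply/cvgr0Pnorm_lt => e e0; have [d d0 ed] := ge0_complexR (ltW e0).
have {}d0 : 0 < d by move: e0; rewrite ed -(rmorph0 (real_complex R)) ltcR.
have : (fun n => b * s ^+ n) @ \oo --> (b * 0 : R).
  by apply: cvgMr; apply: cvg_expr; rewrite ger0_norm.
rewrite mulr0 => /cvgr0Pnorm_lt/(_ d d0); apply: filterS => n.
rewrite ger0_norm ?mulr_ge0 ?exprn_ge0 // => bsd.
apply: le_lt_trans (uB n) _; rewrite Bb rs ed -rmorphXn -rmorphM /=.
by rewrite ltcR.
Qed.

Lemma complex_norm_Re (R : realType) (z : R[i]) :
  ((`|complex.Re z|)%:C)%C <= `|z|.
Proof.
rewrite normc_def lecR -sqrtr_sqr ler_wsqrtr // lerDl sqr_ge0 //.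
Qed.

Lemma complex_norm_Im (R : realType) (z : R[i]) :
  ((`|complex.Im z|)%:C)%C <= `|z|.
Proof.
rewrite normc_def lecR -sqrtr_sqr ler_wsqrtr // lerDr sqr_ge0 //.
Qed.

(** The telescoping series of the differences converges absolutely by comparison with a geometric
    series. *)
Lemma real_cvg_geometric (R : realType) (u : nat -> R) (b s : R) :
  0 <= s < 1 -> (forall n, `|u n.+1 - u n| <= b * s ^+ n) -> cvgn u.
Proof.
move=> /andP[s0 s1] ub.
have b0 : 0 <= b by have := ub 0; rewrite expr0 mulr1; apply: le_trans.
have := @normed_cvg R R^o (telescope u).
have -> : u = (fun n => u 0 + series (telescope u) n).
  by apply/funext => n; rewrite -eq_sum_telescope.
move=> H; apply: is_cvgD; first exact: is_cvg_cst.
rewrite -(_ : u = (fun n => u 0 + series (telescope u) n)) in H *; last first.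
  by apply/funext => n; rewrite -eq_sum_telescope.
apply: H; apply: (@series_le_cvg _ _ (geometric b s)) => [n|n|n|] //=.
- by rewrite mulr_ge0 // exprn_ge0.
- exact: ub.
by apply: is_cvg_geometric_series; rewrite ger0_norm.
Qed.

Lemma complex_cvg (R : realType) (u : nat -> R[i]^o) :
  cvgn (fun n => complex.Re (u n)) -> cvgn (fun n => complex.Im (u n)) ->
  cvgn u.
Proof.
move=> /cvg_ex[/= x ux] /cvg_ex[/= y uy].
apply/cvg_ex; exists (x +i* y)%C.
apply/cvgrPdist_lt => e e0; have [d d0 ed] := ge0_complexR (ltW e0).
have {}d0 : 0 < d by move: e0; rewrite ed -(rmorph0 (real_complex R)) ltcR.
have d2 : 0 < d / 2 by rewrite divr_gt0.
move/cvgrPdist_lt : ux => /(_ _ d2) ux; move/cvgrPdist_lt : uy => /(_ _ d2) uy.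
near=> n.
have Hx : `|x - complex.Re (u n)| < d / 2 by near: n.
have Hy : `|y - complex.Im (u n)| < d / 2 by near: n.
have -> : (x +i* y)%C - u n = ((x - complex.Re (u n)) +i* (y - complex.Im (u n)))%C.
  by case: (u n).
rewrite ed normc_def ltcR /= -[ltRHS](ger0_norm (ltW d0)) -sqrtr_sqr.
rewrite ltr_sqrt ?exprn_gt0 //.
(* Two legs shorter than $d/2$ have squares adding up to less than $d^2$. *)
move: Hx Hy; rewrite !ltr_norml => /andP[x1 x2] /andP[y1 y2]; nra.
Unshelve. all: by end_near. Qed.

Lemma complex_cvg_geometric (R : realType) (u : nat -> R[i]^o) (B r : R[i]) :
  0 <= r < 1 -> (forall n, `|u n.+1 - u n| <= B * r ^+ n) -> cvgn u.
Proof.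
move=> /andP[r0 r1] uB.
have B0 : 0 <= B by have := uB 0; rewrite expr0 mulr1; apply: le_trans.
have [b b0 Bb] := ge0_complexR B0; have [s s0 rs] := ge0_complexR r0.
have s1 : s < 1 by move: r1; rewrite rs -(rmorph1 (real_complex R)) ltcR.
have bound n : B * r ^+ n = ((b * s ^+ n)%:C)%C.
  by rewrite Bb rs -rmorphXn -rmorphM.
apply: complex_cvg; apply: (@real_cvg_geometric _ _ b s); rewrite ?s0 // => n.
  rewrite -lecR -bound; apply: le_trans (uB n).
  by apply: le_trans (complex_norm_Re _); rewrite raddfB.
rewrite -lecR -bound; apply: le_trans (uB n).
by apply: le_trans (complex_norm_Im _); rewrite raddfB.
Qed.

(** Consecutive partial products differ by $aQ^n$ times a partial product, and the latter are
    uniformly bounded. *)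
Lemma qpoch_cvg (R : realType) (a Q : R[i]) : `|Q| < 1 ->
  (fun n => \prod_(0 <= j < n) (1 - a * Q ^+ j) : R[i]^o) @ \oo -->
  (qpoch a Q : R[i]^o).
Proof.
move=> Q1; have Q01 : 0 <= `|Q| < 1 by rewrite normr_ge0.
have [B B0 PB] := prod_geometric_bounded (normr_ge0 a) Q01.
(* As [qpoch] is by definition the limit of this sequence, only convergence has to be shown. *)
apply: (complex_cvg_geometric (B := B * `|a|) Q01) => n.
rewrite !big_mkord big_ord_recr /= -[X in _ - X]mulr1 -mulrBr addrAC subrr add0r.
rewrite mulrN normrN !normrM normrX mulrA ler_wpM2r ?exprn_ge0 //.
rewrite ler_wpM2r // normr_prod; apply: le_trans (PB n).
apply: ler_prod => i _; rewrite normr_ge0 /=.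
by rewrite (le_trans (ler_normB _ _)) // normr1 normrM normrX.
Qed.

(** Since $|Q| \le |a|$, each factor satisfies $|1 - aQ^i| \ge 1 - |a|^{i+1}$, so [geometric_bound]
    bounds the inverses of the partial products uniformly. *)
Lemma qpoch_neq0 (R : realType) (a Q : R[i]) : `|a| < 1 -> `|Q| <= `|a| ->
  qpoch a Q != 0.
Proof.
move=> a1 Qa; have a01 : 0 <= `|a| < 1 by rewrite normr_ge0.
have a1' : 0 < 1 - `|a| by rewrite subr_gt0.
have [|B B0 PB] := prod_geometric_bounded (a := `|a| / (1 - `|a|)) _ a01.
  by rewrite divr_ge0 // ltW.
have low n : 1 <= `|\prod_(0 <= j < n) (1 - a * Q ^+ j)| * B.
  rewrite big_mkord normr_prod; apply: (@le_trans _ _ (\prod_(i < n) `|1 - a * Q ^+ i| *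
     \prod_(i < n) (1 + `|a| / (1 - `|a|) * `|a| ^+ i))); last first.
    by rewrite ler_wpM2l // prodr_ge0.
  rewrite -big_split /=; elim/big_ind: _ => // [x y|i _]; first exact: mulr_ege1.
  have ai : 0 <= `|a| ^+ i.+1 <= `|a|.
    by rewrite exprn_ge0 //= exprS ler_piMr // exprn_ile1 // ltW.
  apply: le_trans (geometric_bound ai a1) _.
  rewrite exprS (mulrAC `|a| _ (`|a| ^+ i)) ler_wpM2r //.
    by rewrite addr_ge0 // !mulr_ge0 ?exprn_ge0 // invr_ge0 ltW.
  apply: le_trans (lerB_dist _ _); rewrite normr1 lerD2l lerN2.
  by rewrite normrM normrX ler_wpM2l // lerXn2r ?nnegrE.
apply/eqP => q0; have := @qpoch_cvg R a Q (le_lt_trans Qa a1).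
(* The bound [B] is only known to be nonnegative; [B + 1] can be inverted. *)
have B1 : 0 < B + 1 by rewrite ltr_wpDl.
rewrite q0 => /cvgr0Pnorm_lt/(_ (B + 1)^-1); rewrite invr_gt0 => /(_ B1)[n _].
move=> /(_ n (leqnn n)) /=; rewrite -[ltRHS]mul1r ltr_pdivlMr // mulrDr mulr1.
move=> lt1; have := le_lt_trans (le_trans (low n) _) lt1.
by rewrite lerDl normr_ge0 ltxx => /(_ isT).
Qed.

(** * Passage to the limit *)

(* For an abstract [K]: with [K = R[i]], unification against [cvgM] diverges. *)
Lemma cvg_mul (K : numFieldType) (f g : nat -> K^o) (a b : K) :
  f @ \oo --> (a : K^o) -> g @ \oo --> (b : K^o) ->
  (fun n => f n * g n : K^o) @ \oo --> (a * b : K^o).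
Proof. exact: cvgM. Qed.

Lemma cvg_add (K : numFieldType) (f g : nat -> K^o) (a b : K) :
  f @ \oo --> (a : K^o) -> g @ \oo --> (b : K^o) ->
  (fun n => f n + g n : K^o) @ \oo --> (a + b : K^o).
Proof. exact: cvgD. Qed.

Lemma cvg_pow (K : numFieldType) (f : nat -> K^o) (a : K) (m : nat) :
  f @ \oo --> (a : K^o) -> (fun n => f n ^+ m : K^o) @ \oo --> (a ^+ m : K^o).
Proof.
move=> fa; elim: m => [|m IHm]; first exact: cvg_cst.
by rewrite exprS; under eq_fun do rewrite exprS; apply: cvg_mul.
Qed.

Lemma cvg_inv (K : numFieldType) (f : nat -> K^o) (a : K) : a != 0 ->
  f @ \oo --> (a : K^o) -> (fun n => (f n)^-1 : K^o) @ \oo --> (a^-1 : K^o).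
Proof. exact: cvgV. Qed.

Lemma tprod_cvg (R : realType) (c q : R[i]) (a d : nat) : `|q| < 1 -> (0 < d)%N ->
  (fun n => (tprod c a d n).[q] : R[i]^o) @ \oo -->
  (qpoch (- (c * q ^+ a)) (q ^+ d) : R[i]^o).
Proof.
move=> q1 d0; have qd : `|q ^+ d| < 1 by rewrite normrX exprn_ilt1 // -lt0n.
have -> : (fun n => (tprod c a d n).[q] : R[i]^o) =
    (fun n => \prod_(0 <= j < n) (1 - - (c * q ^+ a) * (q ^+ d) ^+ j) : R[i]^o).
  apply/funext => n; rewrite big_mkord horner_prod; apply: eq_bigr => i _.
  by rewrite !hornerE exprD exprM mulNr opprK mulrA.
exact: qpoch_cvg.
Qed.

Lemma tprodN1_horner_neq0 (K : numFieldType) (q : K) (a d n : nat) :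
  `|q| < 1 -> (0 < a)%N -> (tprod (-1) a d n).[q] != 0.
Proof.
move=> q1 a0; rewrite horner_prod; apply/prodf_neq0 => i _.
have : `|q ^+ (a + d * i)| < 1.
  by rewrite normrX exprn_ilt1 // addn_eq0 negb_and -lt0n a0.
rewrite !hornerE mulN1r subr_eq0 eq_sym; apply: contraTneq => ->.
by rewrite normr1 ltxx.
Qed.

(** Truncation discards the degrees at which [signed_gf], with multiplicities cut at [N], may miss
    partitions. *)
Lemma N2_take (A : comNzRingType) (k N : nat) :
  take_poly N (signed_gf 1 k N.*2 N + signed_gf (-1) k N.*2 N) =
  2%:R * \poly_(n < N) (N2 k n)%:R :> {poly A}.
Proof.
apply/polyP => n; rewrite coef_take_poly -polyC_natr coefCM coef_poly.
case: ltnP => nN; last by rewrite mulr0.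
by rewrite N2_sum coefD !coef_signed_gf //; lia.
Qed.

Lemma Den_cvg (R : realType) (k : nat) (q : R[i]) : `|q| < 1 ->
  (fun N => (Den_poly R[i] k N).[q] : R[i]^o) @ \oo -->
  (qpoch q (q ^+ 2) ^+ k.-1 * qpoch (q ^+ 2) (q ^+ 2) ^+ k : R[i]^o).
Proof.
move=> q1.
have -> : (fun N => (Den_poly R[i] k N).[q] : R[i]^o) =
   (fun N => (tprod (-1) 1 2 N).[q] ^+ k.-1 * (tprod (-1) 2 2 N).[q] ^+ k : R[i]^o).
  by apply/funext => N; rewrite /Den_poly !hornerE.
have c1 := @tprod_cvg R (-1) q 1 2 q1 isT.
have c2 := @tprod_cvg R (-1) q 2 2 q1 isT.
rewrite mulN1r opprK in c1; rewrite mulN1r opprK in c2.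
rewrite expr1 in c1.
exact: (@cvg_mul R[i] _ _ _ _ (@cvg_pow R[i] _ _ k.-1 c1) (@cvg_pow R[i] _ _ k c2)).
Qed.

Lemma Num_cvg (R : realType) (q : R[i]) : `|q| < 1 ->
  (fun N => (Num_poly R[i] N).[q] : R[i]^o) @ \oo -->
  (qpochs [:: q ^+ 16; - q ^+ 6; - q ^+ 10] (q ^+ 16) : R[i]^o).
Proof.
move=> q1; rewrite /qpochs !big_cons big_nil mulr1.
have -> : (fun N => (Num_poly R[i] N).[q] : R[i]^o) =
   (fun N => (tprod (-1) 16 16 N).[q] *
      ((tprod 1 6 16 N).[q] * (tprod 1 10 16 N).[q]) : R[i]^o).
  by apply/funext => N; rewrite /Num_poly !hornerE.
have c1 := @tprod_cvg R (-1) q 16 16 q1 isT.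
have c2 := @tprod_cvg R (1) q 6 16 q1 isT.
have c3 := @tprod_cvg R (1) q 10 16 q1 isT.
rewrite mulN1r opprK in c1; rewrite mul1r in c2; rewrite mul1r in c3.
exact: (@cvg_mul R[i] _ _ _ _ c1 (@cvg_mul R[i] _ _ _ _ c2 c3)).
Qed.

(** The error of the claimed identity after multiplying by the denominator; the factor 2 comes from
    summing over both signs. *)
Definition error_poly (A : comNzRingType) (k N : nat) : {poly A} :=
  2%:R * \poly_(n < N) (N2 k n)%:R * Den_poly A k N - 2%:R * Num_poly A N.

Definition error_majorant (A : comNzRingType) (k N : nat) : {poly A} :=
  (signed_gf 1 k N.*2 N + signed_gf 1 k N.*2 N) *
    (tprod 1 1 2 N ^+ k.-1 * tprod 1 2 2 N ^+ k) +
  (1 + 1) * (tprod 1 16 16 N * (tprod 1 6 16 N * tprod 1 10 16 N)).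

Lemma error_eqX (A : idomainType) (k N : nat) : (0 < k)%N ->
  eqX N (error_poly A k N) 0.
Proof.
move=> k0 i iN; rewrite /error_poly coefB coef0; apply/eqP; rewrite subr_eq0.
apply/eqP; rewrite -(N2_identity A k0 iN) -N2_take.
have e : eqX N (take_poly N (signed_gf 1 k N.*2 N + signed_gf (-1) k N.*2 N))
    (signed_gf (1 : A) k N.*2 N + signed_gf (-1) k N.*2 N).
  by move=> j jN; rewrite coef_take_poly jN.
exact: (eqX_mul e (eqX_refl _) iN).
Qed.

Lemma error_majorantP (K : numDomainType) (k N : nat) :
  majorant (error_poly K k N) (error_majorant K k N).
Proof.
have n1 : `|1 : K| <= 1 by rewrite normr1.
have nN1 : `|-1 : K| <= 1 by rewrite normrN1.
apply: majorantD.
  apply: majorantM.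
    by rewrite -N2_take; apply/majorant_take/majorantD; apply: majorant_signed_gf.
  by apply: majorantM; apply: majorantX; apply: majorant_tprod.
apply: majorantN; apply: majorantM.
  by apply: majorantD; apply: majorant1.
by do ![apply: majorantM]; apply: majorant_tprod.
Qed.

Lemma error_majorant_bounded (R : realType) (k : nat) (rho : R[i]) :
  0 <= rho < 1 ->
  exists B : R[i], forall N, (error_majorant R[i] k N).[rho] <= B.
Proof.
move=> r01; have [r0 r1] := andP r01.
have r01' : 0 <= rho <= 1 by rewrite r0 ltW.
have [B B0 PB] := prod_geometric_bounded (ler01 : 0 <= (1 : R[i])) r01.
have [|D D0 PD] := prod_geometric_bounded (a := rho / (1 - rho)) _ r01.
  by rewrite divr_ge0 // subr_ge0 ltW.
have tB (a d N : nat) : (0 < d)%N -> 0 <= (tprod 1 a d N).[rho] <= B.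
  move=> d0; have /andP[-> /= h] := tprod1_le a N d0 r01'.
  exact: le_trans h (PB N).
have FD N : 0 <= (signed_gf 1 k N.*2 N).[rho] <= D ^+ k.
  have /andP[-> /= h] := signed_gf1_le k N.*2 N r01.
  apply: le_trans h _; apply: lerXn2r (PD _); rewrite ?nnegrE //.
  apply: prodr_ge0 => i _.
  by rewrite addr_ge0 // !mulr_ge0 ?exprn_ge0 // invr_ge0 subr_ge0 ltW.
have mul0 (x X y Y : R[i]) : 0 <= x <= X -> 0 <= y <= Y -> 0 <= x * y <= X * Y.
  by move=> /andP[x0 xX] /andP[y0 yY]; rewrite mulr_ge0 //= ler_pM.
have exp0 (x X : R[i]) n : 0 <= x <= X -> 0 <= x ^+ n <= X ^+ n.
  move=> /andP[x0 xX]; rewrite exprn_ge0 //= lerXn2r ?nnegrE //.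
  exact: le_trans xX.
exists ((D ^+ k + D ^+ k) * (B ^+ k.-1 * B ^+ k) + (1 + 1) * (B * (B * B))) => N.
rewrite /error_majorant !(hornerD, hornerM, horner_exp, hornerC).
have /andP[F0 F1] := FD N.
apply: lerD.
  have two : 0 <= (signed_gf 1 k N.*2 N).[rho] + (signed_gf 1 k N.*2 N).[rho]
      <= D ^+ k + D ^+ k by rewrite addr_ge0 ?lerD.
  by have /andP[_ ->] := mul0 _ _ _ _ two
    (mul0 _ _ _ _ (exp0 _ _ k.-1 (tB 1 2 N isT)) (exp0 _ _ k (tB 2 2 N isT))).
have two : 0 <= (1 + 1 : R[i]) <= 1 + 1 by rewrite lexx addr_ge0.
by have /andP[_ ->] := mul0 _ _ _ _ two
  (mul0 _ _ _ _ (tB 16 16 N isT) (mul0 _ _ _ _ (tB 6 16 N isT) (tB 10 16 N isT))).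
Qed.

Lemma error_cvg (R : realType) (k : nat) (q : R[i]) : (0 < k)%N -> `|q| < 1 ->
  (fun N => (error_poly R[i] k N).[q] : R[i]^o) @ \oo --> (0 : R[i]^o).
Proof.
(* The midpoint of $|q|$ and 1: below 1, so the majorants stay bounded there, and above $|q|$, so
   the ratio $|q|/\rho$ is less than 1. *)
move=> k0 q1; pose rho := (1 + `|q|) / 2.
have q0 := normr_ge0 q.
have rho0 : 0 < rho by rewrite divr_gt0 // ltr_pwDl.
have qrho : `|q| < rho by rewrite ltr_pdivlMr // mulr_natr mulr2n ltrD2r.
have rho1 : rho < 1 by rewrite ltr_pdivrMr // mul1r ltrD2l.
have [|B PB] := @error_majorant_bounded R k rho; first by rewrite ltW.
apply: (@cvg0_geometric _ _ B (`|q| / rho)) => [|N].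
  by rewrite (divr_ge0 q0 (ltW rho0)) ltr_pdivrMr ?mul1r.
apply: le_trans (horner_tail (@error_majorantP _ k N) (@error_eqX _ k N k0)
  rho0 (ltW qrho)) _.
by rewrite mulrC ler_wpM2r // exprn_ge0 // divr_ge0 // ltW.
Qed.

Theorem theorem1p11 (R : realType) (k : nat) (hk : (1 <= k)%N)
    (q : R[i]) (hq : `|q| < 1) :
  series (fun n : nat => (N2 k n)%:R * q ^+ n : R[i]^o) @ \oo -->
  (qpochs [:: q ^+ 16; - q ^+ 6; - q ^+ 10] (q ^+ 16)
   / (qpoch q (q ^+ 2) ^+ (k - 1) * qpoch (q ^+ 2) (q ^+ 2) ^+ k) : R[i]^o).
Proof.
rewrite subn1.
have sumE N : (\poly_(n < N) (N2 k n)%:R).[q] =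
    series (fun n : nat => (N2 k n)%:R * q ^+ n : R[i]^o) N.
  by rewrite horner_poly seriesEord.
have DN0 N : (Den_poly R[i] k N).[q] != 0.
  by rewrite hornerM !horner_exp mulf_neq0 // expf_neq0 // tprodN1_horner_neq0.
(* An infinite product may vanish although no truncation does, so the limit needs its own
   argument. *)
have D0 : qpoch q (q ^+ 2) ^+ k.-1 * qpoch (q ^+ 2) (q ^+ 2) ^+ k != 0.
  by rewrite mulf_neq0 // expf_neq0 // qpoch_neq0 ?normrX ?exprn_ilt1 //
    expr2 ler_piMr // ltW.
(* Solves the definition of [error_poly] for the partial sum, exactly for every [N]. *)
have -> : series (fun n : nat => (N2 k n)%:R * q ^+ n : R[i]^o) =
  (fun N => (2^-1 * (error_poly R[i] k N).[q] + (Num_poly R[i] N).[q])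
            * (Den_poly R[i] k N).[q]^-1 : R[i]^o).
  apply/funext => N; rewrite -sumE /error_poly.
  move: (Den_poly _ _ _) (DN0 N) (Num_poly _ _) => d d0 m.
  rewrite hornerD hornerN !hornerM -polyC_natr hornerC.
  by field; rewrite d0.
have e0 := @error_cvg R k q hk hq.
have c2 : (fun=> 2^-1 : R[i]^o) @ \oo --> (2^-1 : R[i]^o) by exact: cvg_cst.
have he := @cvg_mul R[i] _ _ _ _ c2 e0.
rewrite mulr0 in he.
have hn := @cvg_add R[i] _ _ _ _ he (Num_cvg hq).
rewrite add0r in hn.
exact: (@cvg_mul R[i] _ _ _ _ hn (@cvg_inv R[i] _ _ D0 (@Den_cvg R k q hq))).
Qed.
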